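(* Let $p,d$ be integers with $2\le p\le d$, and let $\tilde k_{ORF}(x,y)$ be the orthogonal-random-features approximate kernel built from $p$ random vectors in $\mathbb{R}^d$. Then for all $x,y\in\mathbb{R}^d$, with $z:=\|x-y\|$, its variance is $$V[\tilde k_{ORF}(x,y)]=\frac1p\left\{\frac{1+j_{d/2-1}(2z)}{2}+(p-1)\,j_{d/2-1}(\sqrt2\,z)-p\,\big(j_{d/2-1}(z)\big)^2\right\},$$ where $j_{d/2-1}$ is the normalized Bessel function of the first kind.
   Context: Let $O$ be a random $d\times d$ orthogonal matrix distributed according to the Haar probability measure on the orthogonal group $O(d)$, and let $w_1,\dots,w_p\in\mathbb{R}^d$ be $p$ distinct columns of $O$ (say the first $p$). For $x\in\mathbb{R}^d$ put $$\tilde\phi_{ORF}(x):=\frac1{\sqrt p}\big(\sin(w_1^\top x),\dots,\sin(w_p^\top x),\cos(w_1^\top x),\dots,\cos(w_p^\top x)\big)^\top\in\mathbb{R}^{2p}.$$ The ORF approximate kernel is $$\tilde k_{ORF}(x,y):=\tilde\phi_{ORF}(x)^\top\tilde\phi_{ORF}(y)=\frac1p\sum_{j=1}^p\cos(w_j^\top(x-y)).$$ $\|\cdot\|$ is the Euclidean norm, and $V$ denotes variance over the randomness of $O$. The normalized Bessel function of the first kind is $$j_{d/2-1}(z)=\sum_{n\ge 0}\frac{(-1)^n\,\Gamma(d/2)}{n!\,\Gamma(n+d/2)}\left(\frac z2\right)^{2n}.$$ *)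

(* Defs.v *)
From HB Require Import structures.
From mathcomp Require Import all_boot all_order all_algebra.
From mathcomp Require Import all_classical all_reals all_analysis.

Set Implicit Arguments.
Unset Strict Implicit.
Unset Printing Implicit Defensive.

Import Order.TTheory GRing.Theory Num.Theory.
Import numFieldNormedType.Exports.

Local Open Scope classical_set_scope.
Local Open Scope ring_scope.

Definition dotv (R : realType) (d : nat) (u v : 'cV[R]_d) : R :=
  (u^T *m v) ord0 ord0.

(* The library norm `|x| on matrices is the sup norm, hence this definition. *)
Definition norm2 (R : realType) (d : nat) (x : 'cV[R]_d) : R :=
  Num.sqrt (dotv x x).

Definition orthogonal_group (R : realType) (d : nat) : set 'M[R]_d :=
  [set Q | Q^T *m Q = 1%:M].

(* Real d x d matrices with the Borel sigma-algebra of their usual topology. *)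
Definition borel_matrix (R : realType) (d : nat) :=
  g_sigma_algebraType (@open 'M[R]_d).

(* A Borel probability measure on the group O(d) is represented by a Borel
   probability measure on all d x d matrices that is carried by O(d).
   Since O(d) is compact, left invariance also implies right invariance. *)
Definition is_haar_orthogonal (R : realType) (d : nat)
    (mu : set (borel_matrix R d) -> \bar R) : Prop :=
  mu (@orthogonal_group R d) = 1%E /\
  forall Q : 'M[R]_d, orthogonal_group Q ->
  forall A : set (borel_matrix R d), measurable A ->
    mu [set Q *m B | B in A] = mu A.

Definition Gamma (R : realType) (x : R) : R :=
  \int[@lebesgue_measure R]_(t in `]0, +oo[) (t `^ (x - 1) * expR (- t)).

Definition normalized_bessel (R : realType) (nu z : R) : R :=
  limn (series (fun n : nat =>
    (-1) ^+ n * Gamma (nu + 1) / (n`!%:R * Gamma (n%:R + nu + 1))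
      * (z / 2) ^+ (2 * n))).

Definition orf_feature (R : realType) (d p : nat) (w : 'I_p -> 'cV[R]_d)
    (x : 'cV[R]_d) : 'cV[R]_(p + p) :=
  (Num.sqrt p%:R)^-1 *:
    col_mx (\col_j sin (dotv (w j) x)) (\col_j cos (dotv (w j) x)).

Definition orf_kernel (R : realType) (d p : nat) (w : 'I_p -> 'cV[R]_d)
    (x y : 'cV[R]_d) : R :=
  dotv (orf_feature w x) (orf_feature w y).

(* Main.v *)
(* For a unit vector [a] and a Haar distributed [B], the law of [B a] is invariant
   under rotations, so [E (v . B a)^(2n) = |v|^(2n) m_n], where [m_n] is the
   moment of order [2n] of a single coordinate of [B a]. Expanding this identity
   for [v = e_1 + t e_k], comparing the coefficients of [t^2], and summing over
   [k] with [|B a|^2 = 1] gives [(2n + 1) m_n = (2n + d) m_(n+1)]. Since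
   [Gamma (x + 1) = x Gamma x], the [m_n] are, up to the factors [(2n)!], the
   coefficients of the Bessel series, and dominated convergence yields
   [E cos (v . B a) = j (|v|)].
   In the variance, a product of two cosines is half the sum of the cosines of
   [v . (w_i + w_j)] and [v . (w_i - w_j)]; for [i <> j] the vectors
   [(w_i +- w_j) / sqrt 2] are again of the form [B a] with [a] a unit vector. *)
Require Import Defs.
From HB Require Import structures.
From mathcomp Require Import all_boot all_order all_algebra.
From mathcomp Require Import all_classical all_reals all_analysis.
From mathcomp Require Import measurable_realfun zify ring lra.

Set Implicit Arguments.
Unset Strict Implicit.
Unset Printing Implicit Defensive.

Import Order.TTheory GRing.Theory Num.Theory.
Import numFieldNormedType.Exports.

Local Open Scope classical_set_scope.
Local Open Scope ring_scope.

(** * The Gamma function *)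

Section Gamma_function.
Variable R : realType.
Implicit Types a x t : R.
Notation mu := (@lebesgue_measure R).

(** An integer power dominates t^a up to a constant, and the Taylor expansion of exp(t/2) dominates
    that power. This gives both the integrability of the Gamma integrand and its decay at
    infinity. *)
Lemma powR_expRN_bound a : 0 <= a ->
  exists2 K, 0 < K &
    forall t, 0 <= t -> t `^ a * expR (- t) <= K * expR (- 2^-1 * t).
Proof.
(* The successor keeps [n] positive: for n = 0 the lower bound 1 + (t/2)^n / n! of exp(t/2) fails at
   t = 0. *)
move=> a0; pose n := (Num.bound a).+1.
have an : a <= n%:R.
  rewrite (le_trans (ltW (archi_boundP a0)))// ler_nat.
  exact: leqnSn.
(* [K] inverts the coefficient of t^n in (t/2)^n / n!; [K1] takes care of the constant term. *)
pose K : R := 2 ^+ n * n`!%:R.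
have K1 : 1 <= K.
  by rewrite /K mulr_ege1// ?exprn_ege1 ?ler1n ?fact_gt0// (ler_nat _ 1 2).
exists K => [|t t0]; first exact: lt_le_trans K1.
have tn : t `^ a <= 1 + t ^+ n.
  have [t1|t1] := leP 1 t.
    rewrite (le_trans (ler_powR t1 an))// powR_mulrn//.
    by rewrite lerDr.
  rewrite -[leLHS]addr0 lerD ?exprn_ge0//.
  have := @ge0_ler_powR _ a a0 t 1; rewrite !nnegrE => /(_ t0 ler01 (ltW t1)).
  by rewrite powR1.
have : 1 + (2^-1 * t) ^+ n / n`!%:R <= expR (2^-1 * t).
  by apply: expR_ge1Dxn; rewrite mulr_ge0.
rewrite -(ler_pM2l (lt_le_trans ltr01 K1)) mulrDr mulr1 => E.
have {}E : 1 + t ^+ n <= K * expR (2^-1 * t).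
  apply: (le_trans _ E); rewrite lerD//.
  rewrite le_eqVlt; apply/orP; left; apply/eqP.
  rewrite /K exprMn exprVn; field.
  by rewrite expf_neq0// pnatr_eq0 -lt0n fact_gt0.
rewrite -(@ler_pM2r _ (expR t)) ?expR_gt0// -[leLHS]mulrA -[leRHS]mulrA.
rewrite -!expRD addNr expR0 mulr1.
rewrite (_ : - 2^-1 * t + t = 2^-1 * t); last by lra.
exact: (le_trans tn E).
Qed.

Let halfexp t := expR (- 2^-1 * t).

Let continuous_halfexp : continuous halfexp.
Proof.
move=> x; apply: continuous_comp; last exact: continuous_expR.
by apply: continuousM; [exact: cst_continuous|exact: cvg_id].
Qed.

Let halfexp_cvg0 : halfexp x @[x --> +oo] --> 0.
Proof.
rewrite (_ : halfexp = (fun z => expR (- z)) \o (fun z => 2^-1 * z)); last first.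
  by apply: eq_fun => x; rewrite mulNr.
apply: (@cvg_comp _ _ _ (fun z => 2^-1 * z) (fun z => expR (- z)) _
  (pinfty_nbhs R)); last exact: cvgr_expR.
exact: gt0_cvgMry.
Qed.

Let integral_halfexp :
  (\int[mu]_(t in `[0%R, +oo[) (halfexp t)%:E = 2%:E)%E.
Proof.
rewrite (@ge0_continuous_FTC2y _ _ (fun t => - 2 * halfexp t) _ 0)//.
- by rewrite /halfexp mulr0 expR0 mulr1 sub0e -EFinN opprK.
- by move=> ? _; exact: expR_ge0.
- exact/continuous_subspaceT/continuous_halfexp.
- by rewrite -(mulr0 (-2)); apply: cvgM; [exact: cvg_cst|].
- apply: cvg_at_right_filter; apply: cvgM; first exact: cvg_cst.
  exact: continuous_halfexp.
- move=> x _; rewrite derive1E derive_val/=.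
  by rewrite /GRing.scale/= /halfexp; lra.
Qed.

Let integrable_halfexp : mu.-integrable `[0, +oo[ (EFin \o halfexp).
Proof.
apply/integrableP; split.
  apply/measurable_EFinP; apply: measurable_funTS.
  by apply: continuous_measurable_fun; exact: continuous_halfexp.
under eq_integral do rewrite /= ger0_norm ?expR_ge0//.
by rewrite integral_halfexp ltry.
Qed.

Let integrable_scale f (k : R) : mu.-integrable `[0, +oo[ (EFin \o f) ->
  mu.-integrable `[0, +oo[ (EFin \o (fun t => k * f t)).
Proof.
move=> fi; rewrite (_ : _ \o _ = (fun t => k%:E * (EFin \o f) t)%E)//.
exact: integrableZl.
Qed.

Let powexp a t := t `^ a * expR (- t).

Let continuous_powexp a : 0 <= a -> {within `[0, +oo[, continuous (powexp a)}.
Proof.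
move=> a0; have cN : continuous (fun t : R => expR (- t)).
  move=> t; apply: continuous_comp; last exact: continuous_expR.
  by apply: continuousN; exact: cvg_id.
apply/continuous_within_itvcyP; split.
  move=> t t0; apply: cvgM; last exact: cN.
  have : derivable (@powR R ^~ a) t 1 by exact: derivable_powR.
  by move=> /derivable1_diffP/differentiable_continuous.
apply: cvgM; last exact/cvg_at_right_filter/cN.
(* At the endpoint 0 the power is 1 if a = 0 and 0 otherwise. *)
have [->|aN0] := eqVneq a 0.
  rewrite powRr0; under eq_fun do rewrite powRr0; exact: cvg_cst.
by rewrite powR0//; apply: powR_cvg0; rewrite lt_neqAle eq_sym aN0.
Qed.

Let powexp_ge0 a t : 0 <= powexp a t.
Proof. by rewrite mulr_ge0 ?powR_ge0 ?expR_ge0. Qed.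

Let integrable_powexp a : 0 <= a -> mu.-integrable `[0, +oo[ (EFin \o powexp a).
Proof.
move=> a0; have [K K0 HK] := powR_expRN_bound a0.
apply: (@le_integrable _ _ _ mu _ _ _ (EFin \o (fun t => K * halfexp t))).
- exact: measurable_itv.
- apply/measurable_EFinP; apply: measurable_funTS; apply: measurable_funM.
    exact: measurable_powR.
  by apply: measurableT_comp => //; exact: measurable_expR.
- move=> t /=; rewrite in_itv/= andbT => t0.
  by rewrite lee_fin !ger0_norm ?powexp_ge0 ?HK// mulr_ge0 ?expR_ge0 ?ltW.
- exact: integrable_scale.
Qed.

Let powexp_cvg0 a : 0 <= a -> powexp a x @[x --> +oo] --> 0.
Proof.
move=> a0; have [K K0 HK] := powR_expRN_bound a0.
apply: (@squeeze_cvgr _ _ _ _ (cst 0) (fun t => K * halfexp t)).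
- near=> t; rewrite powexp_ge0/= HK//.
- exact: cvg_cst.
- by rewrite -(mulr0 K); apply: cvgM; [exact: cvg_cst|].
Unshelve. all: by end_near. Qed.

(** The added endpoint is null; the closed interval suits the fundamental theorem of calculus. *)
Let GammaE x : 1 <= x -> Gamma x = \int[mu]_(t in `[0, +oo[) powexp (x - 1) t.
Proof.
move=> x1; rewrite /Gamma Rintegral_itv_obnd_cbnd//.
apply: (@integrableS _ _ _ mu `[0, +oo[%classic) => //.
  by move=> t /=; rewrite !in_itv/= !andbT => /ltW.
by apply: integrable_powexp; rewrite subr_ge0.
Qed.

(** Integration by parts: -t^x exp(-t) has derivative t^x exp(-t) - x t^(x-1) exp(-t) and vanishes
    at both ends. The range [1 <= x] keeps x - 1 nonnegative and covers the arguments n + d/2 with d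
    >= 2. *)
Lemma GammaD1 x : 1 <= x -> Gamma (x + 1) = x * Gamma x.
Proof.
move=> x1; have x0 : 0 < x by exact: lt_le_trans x1.
have x10 : 0 <= x - 1 by rewrite subr_ge0.
rewrite !GammaE ?addrK ?lerDr ?(ltW x0)//.
have [K K0 HK] := powR_expRN_bound x10.
(* Adding a multiple of [exp (- t / 2)] makes the integrand nonnegative. *)
pose h t := (powexp x t - x * powexp (x - 1) t) + x * K * halfexp t.
have ia := integrable_powexp (ltW x0).
have ib := integrable_powexp x10.
(* The right-hand side is the integral of the added term alone, so the remaining difference
   integrates to zero. *)
have : \int[mu]_(t in `[0, +oo[) h t = x * K * 2.
  rewrite (@Rintegral_ge0_continuous_FTC2y _ _
    (fun t => - powexp x t - 2 * x * K * halfexp t) _ 0)//.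
  - by rewrite /powexp /halfexp mulr0 powR0 ?gt_eqF// mul0r expR0; lra.
  - move=> t t0; rewrite /h -addrA addr_ge0 ?powexp_ge0// addrC.
    by rewrite -mulrA -mulrBr mulr_ge0 ?subr_ge0 ?HK// ltW.
  - have c1 := continuous_powexp (ltW x0).
    have c2 := continuous_powexp x10.
    have c3 : {within `[0, +oo[, continuous halfexp}.
      exact/continuous_subspaceT/continuous_halfexp.
    move=> t; rewrite /h; apply: cvgD; first apply: cvgB.
    + exact: c1.
    + by apply: cvgM; [exact: cvg_cst|exact: c2].
    + by apply: cvgM; [exact: cvg_cst|exact: c3].
  - rewrite -[X in _ --> X]subr0 -[X in _ --> X - _]oppr0.
    rewrite -[X in _ --> _ - X](mulr0 (2 * x * K)); apply: cvgB.
      by apply: cvgN; exact/powexp_cvg0/ltW.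
    by apply: cvgM; [exact: cvg_cst|].
  - move=> t t0; apply: derivableB; last by [].
    apply: derivableN; apply: derivableM; last by [].
    by apply: derivable_powR; rewrite in_itv/= t0.
  - apply: cvgB.
      apply: cvgN.
      by have /continuous_within_itvcyP[] := continuous_powexp (ltW x0).
    by apply: cvgM; [exact: cvg_cst|exact/cvg_at_right_filter/continuous_halfexp].
  - move=> t t0.
    have D1 : derivable (@powR R ^~ x) t 1 by exact: derivable_powR.
    have D2 : is_derive t 1 (@powR R ^~ x) (x * t `^ (x - 1)).
      by apply: DeriveDef => //; rewrite -derive1E powR_derive1.
    rewrite derive1E /powexp derive_val/=.
    by rewrite /GRing.scale/= /h /powexp /halfexp; lra.
rewrite RintegralD//; last 2 first.
- rewrite (_ : _ \o _ = (EFin \o powexp x) \-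
      (EFin \o (fun t => (x * powexp (x - 1) t)%R)))%E//.
  by apply: integrableB => //; exact: integrable_scale.
- exact: integrable_scale.
rewrite RintegralB//; last exact: integrable_scale.
rewrite !RintegralZl// [X in _ + _ * X]/Rintegral integral_halfexp/=.
by move=> ?; lra.
Qed.

(** The integrand is at least exp(-2) on [1, 2]. Positivity is what keeps the denominators of the
    moments and of the Bessel coefficients nonzero. *)
Lemma Gamma_gt0 x : 1 <= x -> 0 < Gamma x.
Proof.
move=> x1; have x10 : 0 <= x - 1 by rewrite subr_ge0.
rewrite GammaE//; have ib := integrable_powexp x10.
have i12 : mu.-integrable `[1, 2] (EFin \o powexp (x - 1)).
  apply: integrableS ib => //.
  by move=> t /=; rewrite !in_itv/= andbT => /andP[t1 _]; rewrite (le_trans _ t1).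
have H : expR (-2) <= \int[mu]_(t in `[1, 2]) powexp (x - 1) t.
  rewrite (_ : expR (-2) = \int[mu]_(t in `[1, 2]) expR (-2)); last first.
    rewrite Rintegral_cst//= lebesgue_measure_itv/= lte_fin ltr1n -EFinB/=; lra.
  apply: le_Rintegral => //.
    apply: measurable_bounded_integrable => //; last exact: bounded_cst.
    by rewrite /= lebesgue_measure_itv/= lte_fin ltr1n -EFinB ltry.
  move=> t /=; rewrite in_itv/= => /andP[t1 t2].
  rewrite -[leLHS]mul1r ler_pM ?expR_ge0 ?ler_expR ?lerN2//.
  by have := ler_powR t1 x10; rewrite powRr0.
apply: (lt_le_trans (expR_gt0 (-2))); apply: (le_trans H).
rewrite /Rintegral fine_le ?integrable_fin_num//.
apply: ge0_subset_integral => //.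
- by have /integrableP[] := ib.
- by move=> t _; rewrite lee_fin powexp_ge0.
- by move=> t /=; rewrite !in_itv/= andbT => /andP[t1 _]; rewrite (le_trans _ t1).
Qed.

End Gamma_function.

(** * Dot products and orthogonal matrices *)

Section dot_product.
Variables (R : realType) (d : nat).
Implicit Types (u v w a : 'cV[R]_d) (Q B : 'M[R]_d).

Lemma dotvE u v : dotv u v = \sum_i u i ord0 * v i ord0.
Proof. by rewrite /dotv mxE; apply: eq_bigr => i _; rewrite mxE. Qed.

Lemma dotvC u v : dotv u v = dotv v u.
Proof. by rewrite !dotvE; apply: eq_bigr => i _; rewrite mulrC. Qed.

Lemma dotvDl u v w : dotv (u + v) w = dotv u w + dotv v w.
Proof. by rewrite /dotv linearD/= mulmxDl mxE. Qed.

Lemma dotvZl (k : R) u v : dotv (k *: u) v = k * dotv u v.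
Proof. by rewrite /dotv linearZ/= -scalemxAl mxE. Qed.

Lemma dotvDr u v w : dotv u (v + w) = dotv u v + dotv u w.
Proof. by rewrite /dotv mulmxDr mxE. Qed.

Lemma dotvZr (k : R) u v : dotv u (k *: v) = k * dotv u v.
Proof. by rewrite /dotv -scalemxAr mxE. Qed.

Lemma dotvBl u v w : dotv (u - v) w = dotv u w - dotv v w.
Proof. by rewrite -scaleN1r dotvDl dotvZl mulN1r. Qed.

Lemma dotvBr u v w : dotv u (v - w) = dotv u v - dotv u w.
Proof. by rewrite -scaleN1r dotvDr dotvZr mulN1r. Qed.

Lemma dotv_mulmxr u v Q : dotv u (Q *m v) = dotv (Q^T *m u) v.
Proof. by rewrite /dotv trmx_mul trmxK mulmxA. Qed.

Lemma dotv_ge0 u : 0 <= dotv u u.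
Proof. by rewrite dotvE; apply: sumr_ge0 => i _; exact: sqr_ge0. Qed.

Lemma dotv_eq0 u : dotv u u = 0 -> u = 0.
Proof.
move=> /eqP; rewrite dotvE psumr_eq0 => [/allP h|i _]; last exact: sqr_ge0.
apply/colP => i; rewrite [RHS]mxE; apply/eqP.
by have /= := h i (mem_index_enum _); rewrite mulf_eq0 orbb.
Qed.

Lemma dotv_delta i v : dotv (delta_mx i ord0) v = v i ord0.
Proof.
rewrite dotvE (bigD1 i)//= big1 ?addr0 => [|j ji].
  by rewrite mxE !eqxx mul1r.
by rewrite mxE (negbTE ji) mul0r.
Qed.

Lemma norm2_ge0 u : 0 <= norm2 u.
Proof. exact: sqrtr_ge0. Qed.

Lemma sqr_norm2 u : norm2 u ^+ 2 = dotv u u.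
Proof. by rewrite sqr_sqrtr ?dotv_ge0. Qed.

Lemma norm2Z (k : R) u : 0 <= k -> norm2 (k *: u) = k * norm2 u.
Proof.
move=> k0; rewrite /norm2 dotvZl dotvZr mulrA -expr2.
by rewrite sqrtrM ?sqr_ge0// sqrtr_sqr ger0_norm.
Qed.

Lemma orthogonal_trmx Q : orthogonal_group Q -> orthogonal_group Q^T.
Proof. by rewrite /orthogonal_group/= trmxK => /mulmx1C. Qed.

Lemma orthogonal_mulmx Q B :
  orthogonal_group Q -> orthogonal_group B -> orthogonal_group (Q *m B).
Proof.
rewrite /orthogonal_group/= => hQ hB.
by rewrite trmx_mul mulmxA -(mulmxA B^T) hQ mulmx1.
Qed.

Lemma dotv_orthogonal Q u v :
  orthogonal_group Q -> dotv (Q *m u) (Q *m v) = dotv u v.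
Proof. by move=> hQ; rewrite dotv_mulmxr mulmxA hQ mul1mx. Qed.

(* The Householder reflection in the hyperplane orthogonal to [v - w]. *)
Lemma orthogonal_transitive v w : dotv v v = dotv w w ->
  exists2 Q, orthogonal_group Q & Q *m v = w.
Proof.
move=> vw; have [<-|vNw] := eqVneq v w.
  by exists 1%:M; rewrite /orthogonal_group/= ?trmx1 mul1mx.
pose x := v - w; pose N := dotv x x.
have N0 : N != 0.
  by apply: contraNneq vNw => /dotv_eq0 /eqP; rewrite subr_eq0.
(* Equality of the squared lengths enters here; it makes the reflection subtract exactly [x] from
   [v]. *)
have xv : N = 2 * dotv x v.
  rewrite /N /x !(dotvBl, dotvBr) vw (dotvC w v).
  by ring.
(* Since [S] is symmetric and squares to [N *: S], the matrix 1 - (2 / N) S is symmetric and its own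
   inverse. *)
pose S := x *m x^T.
have SS : S *m S = N *: S.
  rewrite /S mulmxA -(mulmxA x).
  rewrite (_ : x^T *m x = N%:M); last by apply/mx11_scalar.
  by rewrite mul_mx_scalar -scalemxAl.
have ST : S^T = S by rewrite /S trmx_mul trmxK.
have HT : (1%:M - (2 / N) *: S)^T = 1%:M - (2 / N) *: S.
  by rewrite linearB/= linearZ/= ST trmx1.
exists (1%:M - (2 / N) *: S).
  rewrite /orthogonal_group/= HT.
  rewrite mulmxBl mul1mx !mulmxBr mulmx1 -scalemxAl -scalemxAr SS !scalerA.
  rewrite opprB -addrA -[RHS]addr0; congr (_ + _).
  rewrite -!scaleNr -!scalerDl [X in X *: _](_ : _ = 0) ?scale0r//.
  by rewrite /GRing.scale/=; field.
rewrite mulmxBl mul1mx -scalemxAl /S -mulmxA.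
rewrite (_ : x^T *m v = (dotv x v)%:M); last by apply/mx11_scalar.
rewrite mul_mx_scalar scalerA xv.
rewrite (_ : 2 / _ * _ = 1); last first.
  by field; move: N0; rewrite xv mulf_eq0 negb_or => /andP[].
by rewrite scale1r /x opprB addrCA subrr addr0.
Qed.

Lemma sum_sqr_orthogonal B a : orthogonal_group B ->
  \sum_i dotv (delta_mx i ord0) (B *m a) ^+ 2 = dotv a a.
Proof.
move=> hB; rewrite -(dotv_orthogonal a a hB) [RHS]dotvE.
by apply: eq_bigr => i _; rewrite dotv_delta.
Qed.

(** The vector (u.u) v - (u.v) u has squared length (u.u) ((u.u)(v.v) - (u.v)^2), which is
    nonnegative. The inequality serves to bound v . B a uniformly over O(d). *)
Lemma cauchy_schwarz_dotv u v : `|dotv u v| <= norm2 u * norm2 v.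
Proof.
rewrite -(@ler_pXn2r _ 2)// ?nnegrE ?mulr_ge0 ?norm2_ge0//.
rewrite exprMn !sqr_norm2 real_normK ?num_real//.
have [u0|u0] := eqVneq (dotv u u) 0.
  by rewrite u0 (dotv_eq0 u0) -(scale0r 0) dotvZl !mul0r expr0n.
have := dotv_ge0 (dotv u u *: v - dotv u v *: u).
rewrite !(dotvBl, dotvBr, dotvZl, dotvZr) (dotvC v u).
rewrite [leRHS](_ : _ = dotv u u * (dotv u u * dotv v v - dotv u v ^+ 2)); last first.
  by ring.
by rewrite pmulr_rge0 ?subr_ge0// lt_neqAle eq_sym u0 dotv_ge0.
Qed.

End dot_product.

(** * Integration against the Haar measure *)

Section borel_matrix_theory.
Variables (R : realType) (d : nat).
Notation M := (borel_matrix R d).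

(** Balls of matrices are entrywise, each entry of the product is a finite linear combination of
    coordinates, and finitely many neighbourhoods can be intersected. *)
Lemma continuous_mulmxr (Q : 'M[R]_d) : continuous (fun B : 'M[R]_d => Q *m B).
Proof.
move=> B s /nbhs_ballP[e /= e0 es].
have cE i j : \forall A \near B, ball ((Q *m B) i j) e ((Q *m A) i j).
  have cF : continuous (fun A : 'M[R]_d => (Q *m A) i j).
    have -> : (fun A : 'M[R]_d => (Q *m A) i j) =
              (fun A : 'M[R]_d => \sum_k Q i k * A k j).
      by apply/funext => A; rewrite mxE.
    apply: continuous_big => [|k _]; first exact: add_continuous.
    by move=> A; apply: continuousM; [exact: cst_continuous|exact: coord_continuous].
  by have /cvg_ballP := cF B; apply.
have : \forall A \near B, forall ij : 'I_d * 'I_d,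
    ball ((Q *m B) ij.1 ij.2) e ((Q *m A) ij.1 ij.2).
  by apply: (@filter_forall _ _ _ (nbhs B) (nbhs_filter B)) => ij; exact: cE.
apply: (@filterS _ (nbhs B) (nbhs_filter B)) => A hA.
by apply: es; split => // i j; exact: (hA (i, j)).
Qed.

Lemma measurable_coord i j :
  measurable_fun [set: M] (fun B : M => (B : 'M[R]_d) i j).
Proof.
apply: (measurability _ (RGenOpens.measurableE R)) => _ [_ [a [b ->] <-]].
rewrite setTI; apply: sub_sigma_algebra.
have /continuousP := @coord_continuous R d d i j.
by apply; exact: interval_open.
Qed.

Lemma measurable_mulmxr (Q : 'M[R]_d) :
  measurable_fun [set: M] (fun B : M => (Q *m B : M)).
Proof.
apply: (@measurability _ _ M M setT _ (@open 'M[R]_d : set (set M)) erefl).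
move=> _ [U oU <-].
rewrite setTI; apply: sub_sigma_algebra.
by have /continuousP := @continuous_mulmxr Q; exact.
Qed.

Lemma measurable_dotv_mulmx (v a : 'cV[R]_d) :
  measurable_fun [set: M] (fun B : M => dotv v ((B : 'M[R]_d) *m a)).
Proof.
under eq_fun do rewrite dotvE.
apply: measurable_sum => i; apply: measurable_funM => //.
under eq_fun do rewrite mxE.
apply: measurable_sum => j; apply: measurable_funM => //.
exact: measurable_coord.
Qed.

(** O(d) is the zero set of a measurable function, the sum of the squared entries of B^T B - 1. *)
Lemma measurable_orthogonal_group : measurable (@orthogonal_group R d : set M).
Proof.
pose F (B : M) : R :=
  \sum_(ij : 'I_d * 'I_d)
    ((\sum_k (B : 'M[R]_d) k ij.1 * (B : 'M[R]_d) k ij.2) - (ij.1 == ij.2)%:R) ^+ 2.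
rewrite (_ : (@orthogonal_group R d : set M) = F @^-1` [set 0]).
  rewrite -[_ @^-1` _]setTI.
  have mF : measurable_fun [set: M] F.
    apply: measurable_sum => ij; apply: measurable_funX.
    apply: measurable_funB => //; apply: measurable_sum => k.
    by apply: measurable_funM; exact: measurable_coord.
  exact: mF.
have BE (B : M) i j : ((B : 'M[R]_d)^T *m (B : 'M[R]_d)) i j =
    \sum_k (B : 'M[R]_d) k i * (B : 'M[R]_d) k j.
  by rewrite mxE; apply: eq_bigr => k _; rewrite mxE.
apply/seteqP; split => B; rewrite /orthogonal_group /F/= => H.
  by apply: big1 => -[i j] _; rewrite -BE H mxE subrr expr0n.
move/eqP: H; rewrite psumr_eq0 => [/allP H|ij _]; last exact: sqr_ge0.
apply/matrixP => i j; have /= := H (i, j) (mem_index_enum _).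
by rewrite sqrf_eq0 subr_eq0 BE mxE => /eqP.
Qed.

End borel_matrix_theory.

(** * Expectation over O(d) and its left invariance *)

Section haar_expectation.
Variables (R : realType) (d : nat).
Notation M := (borel_matrix R d).
Notation D := (@orthogonal_group R d).
Variable mu : probability M R.
Hypothesis hmu : is_haar_orthogonal mu.
Implicit Types f g : M -> R.

Let mD : measurable (D : set M). Proof. exact: measurable_orthogonal_group. Qed.

(** The bound is asked only on O(d), where polynomials in the entries are bounded. Closure under
    sums, products and powers then makes the integrands below integrable. *)
Definition bounded_measurable f := measurable_fun [set: M] f /\
  exists C, forall B : M, D B -> `|f B| <= C.

Lemma bounded_measurable_integrable f :
  bounded_measurable f -> mu.-integrable D (EFin \o f).
Proof.
move=> [mf [C fC]]; apply: measurable_bounded_integrable => //.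
- by rewrite (le_lt_trans (probability_le1 _ _)) ?ltry.
- exact: measurable_funTS.
- exists C; split; rewrite ?num_real// => x Cx B DB.
  exact: le_trans (fC B DB) (ltW Cx).
Qed.

Lemma bounded_measurable_cst (k : R) : bounded_measurable (fun=> k).
Proof. by split => //; exists `|k|. Qed.

Lemma bounded_measurableD f g : bounded_measurable f -> bounded_measurable g ->
  bounded_measurable (fun B => f B + g B).
Proof.
move=> [mf [C fC]] [mg [K gK]]; split; first exact: measurable_funD.
by exists (C + K) => B DB; rewrite (le_trans (ler_normD _ _))// lerD ?fC ?gK.
Qed.

Lemma bounded_measurableM f g : bounded_measurable f -> bounded_measurable g ->
  bounded_measurable (fun B => f B * g B).
Proof.
move=> [mf [C fC]] [mg [K gK]]; split; first exact: measurable_funM.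
by exists (C * K) => B DB; rewrite normrM ler_pM ?fC ?gK.
Qed.

Lemma bounded_measurableX f n : bounded_measurable f ->
  bounded_measurable (fun B => f B ^+ n).
Proof.
move=> [mf [C fC]]; split; first exact: measurable_funX.
exists (C ^+ n) => B DB; rewrite normrX lerXn2r ?nnegrE ?fC//.
by rewrite (le_trans _ (fC B DB)).
Qed.

Lemma bounded_measurable_sum (I : Type) (s : seq I) (P : pred I) (F : I -> M -> R) :
  (forall i, bounded_measurable (F i)) ->
  bounded_measurable (fun B => \sum_(i <- s | P i) F i B).
Proof.
move=> bF; elim: s => [|i s IH].
  under eq_fun do rewrite big_nil; exact: bounded_measurable_cst.
under eq_fun do rewrite big_cons.
by case: (P i) => //; exact: bounded_measurableD.
Qed.

Lemma bounded_measurable_dotv (v a : 'cV[R]_d) :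
  bounded_measurable (fun B => dotv v ((B : 'M[R]_d) *m a)).
Proof.
split; first exact: measurable_dotv_mulmx.
exists (norm2 v * norm2 a) => B DB; rewrite (le_trans (cauchy_schwarz_dotv _ _))//.
by rewrite /norm2 (dotv_orthogonal a a DB).
Qed.

(* The integral is restricted to O(d), which has full measure, because linear
   forms in the entries are bounded there. *)
Definition haarE f : R := \int[mu]_(B in D) f B.

Lemma haarE_cst k : haarE (fun=> k) = k.
Proof. by rewrite /haarE Rintegral_cst//= [X in fine X](proj1 hmu) mulr1. Qed.

Lemma haarED f g : bounded_measurable f -> bounded_measurable g ->
  haarE (fun B => f B + g B) = haarE f + haarE g.
Proof.
by move=> bf bg; apply: RintegralD => //; exact: bounded_measurable_integrable.
Qed.

Lemma haarEZ k f : bounded_measurable f -> haarE (fun B => k * f B) = k * haarE f.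
Proof.
by move=> bf; apply: RintegralZl => //; exact: bounded_measurable_integrable.
Qed.

Lemma haarE_sum (I : Type) (s : seq I) (P : pred I) (F : I -> M -> R) :
  (forall i, bounded_measurable (F i)) ->
  haarE (fun B => \sum_(i <- s | P i) F i B) = \sum_(i <- s | P i) haarE (F i).
Proof.
move=> bF; elim: s => [|i s IH].
  by under [X in haarE X]eq_fun do rewrite big_nil; rewrite haarE_cst big_nil.
under [X in haarE X]eq_fun do rewrite big_cons.
rewrite big_cons; case: (P i) => //; rewrite -IH haarED//.
exact: bounded_measurable_sum.
Qed.

Lemma eq_haarE f g : (forall B, D B -> f B = g B) -> haarE f = haarE g.
Proof. by move=> fg; apply: eq_Rintegral => B; rewrite inE => /fg. Qed.

(** The preimage of a set under B -> Q B is its image under Q^T, so invariance says that this map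
    pushes [mu] forward to itself; it also preserves O(d). The rest is a change of variables. *)
Lemma haarE_mulmx (Q : 'M[R]_d) f : orthogonal_group Q -> bounded_measurable f ->
  haarE (fun B => f (Q *m B : M)) = haarE f.
Proof.
move=> hQ bf; pose phi (B : M) : M := Q *m B.
have mphi : measurable_fun setT phi by exact: measurable_mulmxr.
have phiD : phi @^-1` D = D.
  apply/seteqP; split => B; last exact: orthogonal_mulmx.
  move/(orthogonal_mulmx (orthogonal_trmx hQ)).
  by rewrite /phi mulmxA hQ mul1mx.
have phiE A : phi @^-1` A = [set Q^T *m B | B in A].
  apply/seteqP; split => [B AB|_ [B AB <-]].
    by exists (phi B) => //; rewrite /phi mulmxA hQ mul1mx.
  by rewrite /= /phi mulmxA (mulmx1C hQ) mul1mx.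
have if_ : mu.-integrable (phi @^-1` D) ((EFin \o f) \o phi).
  rewrite phiD; apply: bounded_measurable_integrable.
  case: bf => mf [C fC]; split; first exact: measurableT_comp.
  by exists C => B DB; apply: fC; exact: orthogonal_mulmx.
have mf : measurable_fun [set: M] (EFin \o f) by apply/measurable_EFinP; case: bf.
have := integral_pushforward mphi mf if_ mD.
rewrite phiD /haarE /Rintegral => H; congr fine.
transitivity (\int[mu]_(x in D) ((EFin \o f) \o phi) x)%E => //.
rewrite -H; apply: eq_measure_integral => A mA _.
transitivity (mu [set Q^T *m B | B in A]).
  by rewrite -phiE.
exact: (proj2 hmu _ (orthogonal_trmx hQ) _ mA).
Qed.

(** Some orthogonal Q sends [v] to [w], and (Q v) . B a = v . (Q^T B a), where Q^T is absorbed by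
    invariance. *)
Lemma haarE_dotv (F : R -> R) (v w a : 'cV[R]_d) :
  bounded_measurable (fun B => F (dotv v ((B : 'M[R]_d) *m a))) ->
  dotv v v = dotv w w ->
  haarE (fun B => F (dotv w ((B : 'M[R]_d) *m a))) =
  haarE (fun B => F (dotv v ((B : 'M[R]_d) *m a))).
Proof.
move=> bF /orthogonal_transitive[Q hQ <-].
rewrite -[RHS](haarE_mulmx (orthogonal_trmx hQ))//.
by apply: eq_haarE => B _; rewrite -mulmxA [in RHS]dotv_mulmxr trmxK.
Qed.

End haar_expectation.

(** * Moments of a coordinate *)

(** In characteristic zero the integers below [size (p - q)] are distinct roots of p - q, too many
    for a nonzero polynomial. *)
Lemma horner_inj (R : numFieldType) (p q : {poly R}) :
  (forall t, p.[t] = q.[t]) -> p = q.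
Proof.
move=> pq; apply/eqP; rewrite -subr_eq0; apply/eqP.
apply: (@roots_geq_poly_eq0 _ _ [seq i%:R | i <- iota 0 (size (p - q))]).
- by apply/allP => t _; rewrite rootE !hornerE pq subrr.
- by rewrite map_inj_uniq ?iota_uniq// => i j /eqP; rewrite eqr_nat => /eqP.
- by rewrite size_map size_iota.
Qed.

Lemma coef2_1DX2_exp (R : comNzRingType) n :
  ((1 + 'X^2 : {poly R}) ^+ n)`_2 = n%:R.
Proof.
(* The constant coefficient is carried along because multiplication by X^2 moves it to degree
   two. *)
suff : ((1 + 'X^2 : {poly R}) ^+ n)`_0 = 1 /\
       ((1 + 'X^2 : {poly R}) ^+ n)`_2 = n%:R by case.
elim: n => [|n [IH0 IH2]]; first by rewrite expr0 !coef1.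
rewrite exprSr mulrDr mulr1 !coefD !coefMXn/= IH0 IH2 addr0; split => //.
by rewrite natr1.
Qed.

(** In absolute value the cosine terms are the even terms of the exponential series at |x|. The
    bound is uniform in [N], as dominated convergence requires. *)
Lemma cos_partial_sum_le (R : realType) (x : R) N :
  `|series (cos_coeff' x) N| <= expR `|x|.
Proof.
have coeff_ge0 n : 0 <= exp_coeff `|x| n by rewrite /exp_coeff/= divr_ge0.
have /le_trans : `|series (cos_coeff' x) N| <= series (exp_coeff `|x|) N.*2.
  rewrite /series/=; elim: N => [|N IH]; first by rewrite !big_nil normr0.
  rewrite doubleS !big_nat_recr//= (le_trans (ler_normD _ _))//.
  rewrite -addrA lerD// ler_wpDr ?coeff_ge0//.
  by rewrite /cos_coeff' /exp_coeff/= !normrM normfV normr_nat -exprnP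
    normrX normrN1 expr1n mul1r normrX.
apply; apply: nondecreasing_cvgn_le; last exact: is_cvg_series_exp_coeff.
by apply: nondecreasing_series => n _ _; exact: coeff_ge0.
Qed.

(** * Even moments of a coordinate and the expectation of a cosine *)

Section haar_moments.
Variables (R : realType) (d : nat).
Notation M := (borel_matrix R d).
Notation D := (@orthogonal_group R d : set M).
Variable mu : probability M R.
Hypothesis hmu : is_haar_orthogonal mu.
Variable a : 'cV[R]_d.
Hypothesis a1 : dotv a a = 1.
Variable i0 : 'I_d.

Let L (v : 'cV[R]_d) (B : M) : R := dotv v ((B : 'M[R]_d) *m a).
Let u i := L (delta_mx i ord0).
Let m n := haarE mu (fun B => u i0 B ^+ n).

Let bL v : bounded_measurable (L v). Proof. exact: bounded_measurable_dotv. Qed.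

Let dotv_delta_delta (i j : 'I_d) :
  dotv (delta_mx i ord0) (delta_mx j ord0) = (i == j)%:R :> R.
Proof. by rewrite dotv_delta mxE eqxx andbT. Qed.

(** The vectors [v] and [norm2 v *: delta_mx i0 ord0] have equal length, so [haarE_dotv] exchanges
    them. *)
Let haarE_L_exp v n : haarE mu (fun B => L v B ^+ n) = norm2 v ^+ n * m n.
Proof.
rewrite /m -haarEZ; last exact/bounded_measurableX/bL.
transitivity (haarE mu (fun B => L (norm2 v *: delta_mx i0 ord0) B ^+ n)).
  apply: (haarE_dotv hmu (F := fun x => x ^+ n)).
    exact/bounded_measurableX/bL.
  by rewrite dotvZl dotvZr dotv_delta_delta eqxx mulr1 -expr2 sqr_norm2.
by apply: eq_haarE => B _; rewrite /u /L dotvZl exprMn.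
Qed.

(* Both sides of [E (u_i0 + t u_k)^(2n+2) = (1 + t^2)^(n+1) E u_i0^(2n+2)] are
   polynomials in [t]; their coefficients of [t^2] are compared. *)
Let mixed_moment k n : k != i0 ->
  (2 * n + 1)%:R * haarE mu (fun B => u i0 B ^+ (2 * n) * u k B ^+ 2) =
  m (2 * n.+1).
Proof.
move=> ki0; pose E j := haarE mu (fun B => u i0 B ^+ (2 * n.+1 - j) * u k B ^+ j).
pose p := \poly_(j < (2 * n.+1).+1) ('C(2 * n.+1, j)%:R * E j).
have bE j : bounded_measurable (fun B => u i0 B ^+ (2 * n.+1 - j) * u k B ^+ j).
  by apply: bounded_measurableM; apply: bounded_measurableX; exact: bL.
have pq : p = m (2 * n.+1) *: (1 + 'X^2) ^+ n.+1.
  apply: horner_inj => t; rewrite horner_poly !hornerE.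
  pose v : 'cV[R]_d := delta_mx i0 ord0 + t *: delta_mx k ord0.
  have <- : dotv v v = 1 + t ^+ 2.
    rewrite /v !(dotvDl, dotvDr, dotvZl, dotvZr) !dotv_delta_delta !eqxx.
    by rewrite (negbTE ki0) eq_sym (negbTE ki0)/=; ring.
  rewrite -sqr_norm2 -exprM [RHS]mulrC -haarE_L_exp.
  transitivity (\sum_(j < (2 * n.+1).+1) haarE mu (fun B =>
      ('C(2 * n.+1, j)%:R * t ^+ j) * (u i0 B ^+ (2 * n.+1 - j) * u k B ^+ j))).
    by apply: eq_bigr => j _; rewrite haarEZ// mulrAC.
  rewrite -(haarE_sum hmu); last first.
    move=> j; apply: bounded_measurableM => //; exact: bounded_measurable_cst.
  apply: eq_haarE => B _; rewrite /L dotvDl dotvZl exprDn.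
  by apply: eq_bigr => j _; rewrite exprMn -[RHS]mulr_natl -[LHS]mulrA [t ^+ j * _]mulrCA.
(* Degree two yields C(2n+2, 2) E_2 = (n + 1) m_(2n+2); as C(2n+2, 2) = (2n + 1)(n + 1), the factor
   n + 1 cancels. *)
have : p`_2 = (m (2 * n.+1) *: (1 + 'X^2) ^+ n.+1)`_2 by rewrite pq.
rewrite coefZ coef2_1DX2_exp coef_poly ifT; last by rewrite mulnS.
have -> : E 2 = haarE mu (fun B => u i0 B ^+ (2 * n) * u k B ^+ 2).
  by rewrite /E (_ : 2 * n.+1 - 2 = 2 * n)%N// mulnS addKn.
have -> : 'C(2 * n.+1, 2) = ((2 * n + 1) * n.+1)%N.
  have E2 : (2 * n.+1 * (2 * n.+1).-1 = ((2 * n + 1) * n.+1).*2)%N by lia.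
  by rewrite bin2 E2 doubleK.
rewrite natrM => H; apply: (@mulIf _ n.+1%:R); first by rewrite pnatr_eq0.
by rewrite -H; ring.
Qed.

(** On O(d) the squares u_k^2 sum to 1. Inserting this sum gives one term k = i0 of weight 2n + 1
    and d - 1 mixed terms, each worth one copy of the next moment. *)
Let moment_rec n : (2 * n + 1)%:R * m (2 * n) = (2 * n + d)%:R * m (2 * n.+1).
Proof.
have b k : bounded_measurable (fun B => u i0 B ^+ (2 * n) * u k B ^+ 2).
  by apply: bounded_measurableM; apply: bounded_measurableX; exact: bL.
have -> : m (2 * n) =
    \sum_k haarE mu (fun B => u i0 B ^+ (2 * n) * u k B ^+ 2).
  rewrite -(haarE_sum hmu)//; apply: eq_haarE => B DB.
  by rewrite -mulr_sumr sum_sqr_orthogonal// a1 mulr1.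
rewrite mulr_sumr (bigD1 i0)//= (eq_bigr (fun=> m (2 * n.+1))); last first.
  by move=> k ki0; exact: mixed_moment.
have -> : haarE mu (fun B => u i0 B ^+ (2 * n) * u i0 B ^+ 2) = m (2 * n.+1).
  by apply: eq_haarE => B _; rewrite -exprD mulnS addnC.
rewrite sumr_const cardC1 card_ord -[X in _ + X]mulr_natl -mulrDl -natrD.
(* The index [i0] excludes d = 0, so the truncated predecessor of d is harmless. *)
by congr (_%:R * _); case: (d) i0 => [[]|d' _] //=; rewrite -addnA.
Qed.

(** Induction by [moment_rec]: from n to n + 1 the closed form gains the factor (2n + 1)(2n + 2) /
    (4 (n + 1)(n + d/2)) = (2n + 1) / (2n + d). *)
Let moment_even n : (2 <= d)%N ->
  m (2 * n) = Gamma (d%:R / 2) * (2 * n)`!%:R /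
              (4 ^+ n * n`!%:R * Gamma (n%:R + d%:R / 2)).
Proof.
move=> d2; have d2R : (1 : R) <= d%:R / 2 by rewrite ler_pdivlMr// mul1r ler_nat.
have G0 k : 0 < Gamma (k%:R + d%:R / 2 : R).
  by apply: Gamma_gt0; rewrite (le_trans d2R)// lerDr.
elim: n => [|n IH].
  have := G0 0%N; rewrite add0r => G00.
  rewrite muln0 !fact0 expr0 !mulr1 mul1r mulfV ?gt_eqF//.
  by rewrite /m -(haarE_cst hmu 1); apply: eq_haarE => B _; rewrite expr0.
have dn0 : (2 * n + d)%:R != 0 :> R.
  by rewrite pnatr_eq0 addn_eq0 negb_and orbC -lt0n (leq_trans _ d2).
apply: (mulfI dn0); rewrite -moment_rec IH.
have -> : (n.+1%:R + d%:R / 2 : R) = (n%:R + d%:R / 2) + 1 by rewrite -natr1; ring.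
rewrite GammaD1; last by rewrite (le_trans d2R)// lerDr.
have -> : (2 * n.+1 = (2 * n).+2)%N by rewrite mulnS.
rewrite !factS exprS !natrM.
have n0 : n`!%:R != 0 :> R by rewrite pnatr_eq0 -lt0n fact_gt0.
have g0 : Gamma (n%:R + d%:R / 2 : R) != 0 by rewrite gt_eqF.
have dn0' : n%:R + d%:R / 2 != 0 :> R.
  by rewrite gt_eqF// (lt_le_trans ltr01)// (le_trans d2R)// lerDr.
have e0 : (4 : R) ^+ n != 0 by rewrite expf_neq0.
rewrite -(natr1 (2 * n).+1) -(natr1 (2 * n)) -(natr1 n) (natrD _ (2 * n) d) !(natrM _ 2 n).
by field; rewrite n0 g0 e0 natr1 pnatr_eq0 mulrC -natrM -natrD dn0.
Qed.

Lemma haarE_cos v : (2 <= d)%N ->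
  haarE mu (fun B => cos (dotv v ((B : 'M[R]_d) *m a))) =
  normalized_bessel (d%:R / 2 - 1) (norm2 v).
Proof.
move=> d2; rewrite /normalized_bessel; apply/esym/cvg_lim => //.
pose S N (B : M) := series (cos_coeff' (L v B)) N.
have bc n : bounded_measurable (fun B => cos_coeff' (L v B) n).
  rewrite /cos_coeff'; apply: bounded_measurableM; last exact: bounded_measurable_cst.
  apply: bounded_measurableM; first exact: bounded_measurable_cst.
  exact/bounded_measurableX/bL.
have bS N : bounded_measurable (S N) by exact: bounded_measurable_sum.
(* The Bessel partial sums are the expectations of the cosine partial sums: (2n)! cancels against
   the moment, and 4^n turns |v|^(2n) into (|v|/2)^(2n). *)
rewrite (_ : series _ = fun N => haarE mu (S N)); last first.
  apply/funext => N; rewrite /S /series/= (haarE_sum hmu)//; apply: eq_bigr => n _.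
  have -> : haarE mu (fun B => cos_coeff' (L v B) n) =
      (-1) ^+ n / (2 * n)`!%:R * haarE mu (fun B => L v B ^+ (2 * n)).
    rewrite -haarEZ; last exact/bounded_measurableX/bL.
    by apply: eq_haarE => B _; rewrite /cos_coeff' -exprnP mul2n mulrAC.
  rewrite haarE_L_exp moment_even// !subrK addrA subrK.
  rewrite expr_div_n (exprM 2) (_ : 2 ^+ 2 = 4 :> R); last by rewrite -natrX.
  have f0 : (2 * n)`!%:R != 0 :> R by rewrite pnatr_eq0 -lt0n fact_gt0.
  have n0 : n`!%:R != 0 :> R by rewrite pnatr_eq0 -lt0n fact_gt0.
  have e0 : (4 : R) ^+ n != 0 by rewrite expf_neq0.
  have g0 : Gamma (n%:R + d%:R / 2 : R) != 0.
    rewrite gt_eqF// Gamma_gt0// (@le_trans _ _ (d%:R / 2)) ?lerDr//.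
    by rewrite ler_pdivlMr// mul1r ler_nat.
  by field; rewrite n0 g0 e0 f0.
have mcos : measurable_fun [set: M] (fun B => cos (L v B)).
  apply: measurableT_comp; last exact: (proj1 (bL v)).
  by apply: continuous_measurable_fun; exact: continuous_cos.
(* On O(d) one has |v . B a| <= |v| |a|, so this constant dominates every partial sum. *)
pose C := expR (norm2 v * norm2 a).
have mD : measurable (D : set M) by exact: measurable_orthogonal_group.
have mS N : measurable_fun D (EFin \o S N).
  by apply: measurable_funTS; apply/measurable_EFinP; exact: (proj1 (bS N)).
have mc : measurable_fun D (fun B => (cos (L v B))%:E).
  by apply: measurable_funTS; exact/measurable_EFinP.
have Scos : {ae mu, forall B, D B ->
    (EFin \o S N) B @[N --> \oo] --> (cos (L v B))%:E}.
  by apply: aeW => B _; apply: cvg_EFin; [exact: nearW|exact: cvg_cos_coeff'].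
have iC : mu.-integrable D (EFin \o cst C).
  exact/bounded_measurable_integrable/bounded_measurable_cst.
have SC : {ae mu, forall B N, D B -> (`|(EFin \o S N) B| <= (EFin \o cst C) B)%E}.
  apply: aeW => B N DB; rewrite lee_fin (le_trans (cos_partial_sum_le _ _))//.
  rewrite ler_expR (le_trans (cauchy_schwarz_dotv _ _))//.
  by rewrite /norm2 (dotv_orthogonal a a DB).
have [ic _ icvg] := dominated_convergence mD mS mc Scos iC SC.
by move: icvg; rewrite -(fineK (integrable_fin_num mD ic)) => /fine_cvg.
Qed.

End haar_moments.

(** * The variance of the kernel *)

Section haar_product_of_cosines.
Variables (R : realType) (d : nat).
Notation M := (borel_matrix R d).
Variable mu : probability M R.
Hypothesis hmu : is_haar_orthogonal mu.
Hypothesis d2 : (2 <= d)%N.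
Variable v : 'cV[R]_d.
Notation j := (normalized_bessel (d%:R / 2 - 1 : R)).

Definition coscol (i : 'I_d) (B : M) : R := cos (dotv v (col i (B : 'M[R]_d))).

Lemma bounded_measurable_cos_dotv (w a : 'cV[R]_d) :
  bounded_measurable (fun B : M => cos (dotv w ((B : 'M[R]_d) *m a))).
Proof.
split; last by exists 1 => B _; exact: cos_max.
apply: measurableT_comp; last exact: measurable_dotv_mulmx.
by apply: continuous_measurable_fun; exact: continuous_cos.
Qed.

Lemma bounded_measurable_coscol i : bounded_measurable (coscol i).
Proof.
rewrite (_ : coscol i = fun B : M => cos (dotv v ((B : 'M[R]_d) *m delta_mx i ord0))).
  exact: bounded_measurable_cos_dotv.
by apply/funext => B; rewrite /coscol colE.
Qed.

Lemma haarE_coscol i : haarE mu (coscol i) = j (norm2 v).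
Proof.
rewrite -(haarE_cos hmu _ i v d2 (a := delta_mx i ord0)).
  by apply: eq_haarE => B _; rewrite /coscol colE.
by rewrite dotv_delta mxE !eqxx.
Qed.

Let cosM (s t : R) : cos s * cos t = 2^-1 * cos (s + t) + 2^-1 * cos (s - t).
Proof. by rewrite cosD cosB; lra. Qed.

Lemma haarE_coscol_sqr i :
  haarE mu (fun B => coscol i B * coscol i B) = (1 + j (2 * norm2 v)) / 2.
Proof.
transitivity (haarE mu (fun B : M =>
    2^-1 * cos (dotv (2 *: v) ((B : 'M[R]_d) *m delta_mx i ord0)) + 2^-1)).
  apply: eq_haarE => B _; rewrite /coscol cosM subrr cos0 mulr1 colE dotvZl.
  by rewrite mulr_natl mulr2n.
rewrite haarED; last 2 first.
- apply: bounded_measurableM; first exact: bounded_measurable_cst.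
  exact: bounded_measurable_cos_dotv.
- exact: bounded_measurable_cst.
rewrite haarEZ; last exact: bounded_measurable_cos_dotv.
rewrite (haarE_cst hmu) (haarE_cos hmu _ i)//; last first.
  by rewrite dotv_delta mxE !eqxx.
by rewrite norm2Z//; lra.
Qed.

Let dotv_delta_delta (i k : 'I_d) :
  dotv (delta_mx i ord0) (delta_mx k ord0) = (i == k)%:R :> R.
Proof. by rewrite dotv_delta mxE eqxx andbT. Qed.

Lemma haarE_coscolM i k : i != k ->
  haarE mu (fun B => coscol i B * coscol k B) = j (Num.sqrt 2 * norm2 v).
Proof.
move=> ik; pose s : R := Num.sqrt 2.
have s0 : s != 0 by rewrite sqrtr_eq0 -ltNge.
have ss : s * s = 2 by rewrite -expr2 sqr_sqrtr.
(* The sum and difference of two distinct basis vectors have squared length 2; division by [s]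
   normalizes them, and the factor [s] passes to [v]. *)
pose ap : 'cV[R]_d := s^-1 *: (delta_mx i ord0 + delta_mx k ord0).
pose am : 'cV[R]_d := s^-1 *: (delta_mx i ord0 - delta_mx k ord0).
have ap1 : dotv ap ap = 1.
  rewrite /ap !(dotvZl, dotvZr, dotvDl, dotvDr) !dotv_delta_delta !eqxx.
  by rewrite [k == i]eq_sym (negbTE ik)/= mulrA -invfM ss; lra.
have am1 : dotv am am = 1.
  rewrite /am !(dotvZl, dotvZr, dotvBl, dotvBr) !dotv_delta_delta !eqxx.
  by rewrite [k == i]eq_sym (negbTE ik)/= mulrA -invfM ss; lra.
have E a : dotv a a = 1 ->
    haarE mu (fun B : M => cos (dotv (s *: v) ((B : 'M[R]_d) *m a))) = j (s * norm2 v).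
  by move=> a1; rewrite (haarE_cos hmu a1 i)// norm2Z// sqrtr_ge0.
transitivity (haarE mu (fun B : M =>
    2^-1 * cos (dotv (s *: v) ((B : 'M[R]_d) *m ap)) +
    2^-1 * cos (dotv (s *: v) ((B : 'M[R]_d) *m am)))).
  apply: eq_haarE => B _; rewrite /coscol cosM !colE /ap /am.
  rewrite -!scalemxAr !dotvZl !dotvZr !mulVKf//.
  by rewrite mulmxBr mulmxDr dotvDr dotvBr.
rewrite haarED; last 2 first.
- apply: bounded_measurableM; first exact: bounded_measurable_cst.
  exact: bounded_measurable_cos_dotv.
- apply: bounded_measurableM; first exact: bounded_measurable_cst.
  exact: bounded_measurable_cos_dotv.
rewrite !haarEZ ?E//; first by rewrite -/s; lra.
- exact: bounded_measurable_cos_dotv.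
- exact: bounded_measurable_cos_dotv.
Qed.

End haar_product_of_cosines.

(** * Transfer of expectations from the sample space to the law of the matrix *)

Section haar_distribution.
Variables (R : realType) (d : nat).
Notation M := (borel_matrix R d).
Variables (disp : measure_display) (Omega : measurableType disp).
Variables (P : probability Omega R) (O : {RV P >-> M}).
Hypothesis hO : is_haar_orthogonal (distribution P O).

(** The expectation is an integral over all matrices against the law, for which the complement of
    O(d) is null. The bound on [f] is global because the first integral ranges over all matrices. *)
Lemma expectation_haarE (f : M -> R) (C : R) : measurable_fun [set: M] f ->
  (forall B, `|f B| <= C) ->
  'E_P[fun omega => f (O omega)]%E = (haarE (distribution P O) f)%:E.
Proof.
move=> mf fC; pose mu : probability M R := distribution P O.
have mD : measurable (@orthogonal_group R d : set M).
  exact: measurable_orthogonal_group.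
have ifO : P.-integrable [set: Omega] ((EFin \o f) \o O).
  apply: (@measurable_bounded_integrable _ _ _ P (f \o O)) => //.
  - by rewrite (le_lt_trans (probability_le1 _ _)) ?ltry.
  - exact: measurableT_comp.
  - exists C; split; rewrite ?num_real// => x Cx w _.
    exact: le_trans (fC _) (ltW Cx).
have mfE : measurable_fun [set: M] (EFin \o f) by exact/measurable_EFinP.
have ifm : mu.-integrable [set: M] (EFin \o f).
  apply: (@measurable_bounded_integrable _ _ _ mu f) => //.
  - by rewrite (le_lt_trans (probability_le1 _ _)) ?ltry.
  - exists C; split; rewrite ?num_real// => x Cx w _.
    exact: le_trans (fC _) (ltW Cx).
rewrite unlock -[LHS]/(\int[P]_w ((EFin \o f) \o O) w)%E -integral_distribution//.
have muDC : mu (~` (@orthogonal_group R d : set M)) = 0%E.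
  by rewrite probability_setC// [X in (1 - X)%E](proj1 hO) subee.
rewrite (negligible_integral (measurableC mD) measurableT ifm muDC).
rewrite setTD setCK /haarE /Rintegral fineK//.
by apply: integrable_fin_num => //; exact: integrableS ifm.
Qed.

End haar_distribution.

Lemma orf_kernelE (R : realType) (d p : nat) (w : 'I_p -> 'cV[R]_d) (x y : 'cV[R]_d) :
  orf_kernel w x y = p%:R^-1 * \sum_i cos (dotv (x - y) (w i)).
Proof.
rewrite /orf_kernel /orf_feature dotvZl dotvZr mulrA -invfM -expr2 sqr_sqrtr//.
congr (_ * _); rewrite dotvE big_split_ord/= -big_split/=.
apply: eq_bigr => i _; rewrite !col_mxEu !col_mxEd !mxE.
by rewrite dotvBl (dotvC x) (dotvC y) cosB addrC.
Qed.

Theorem theorem4 (R : realType) (p d : nat) (hp : (2 <= p)%N)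
    (hpd : (p <= d)%N)
    (disp : measure_display) (Omega : measurableType disp)
    (P : probability Omega R)
    (O : {RV P >-> borel_matrix R d})
    (hO : is_haar_orthogonal (distribution P O))
    (c : 'I_p -> 'I_d) (hc : injective c)
    (x y : 'cV[R]_d) :
  let z := norm2 (x - y) in
  let j := normalized_bessel (d%:R / 2 - 1) in
  ('V_P[fun omega => orf_kernel (fun i => col (c i) (O omega)) x y] =
   (p%:R^-1 * ((1 + j (2 * z)) / 2 + (p%:R - 1) * j (Num.sqrt 2 * z)
               - p%:R * j z ^+ 2))%:E)%E.
Proof.
move=> z j; have d2 : (2 <= d)%N := leq_trans hp hpd.
pose v := x - y; pose mu : probability (borel_matrix R d) R := distribution P O.
have p0 : p%:R != 0 :> R by rewrite pnatr_eq0 -lt0n (leq_trans _ hp).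
pose K (B : borel_matrix R d) := \sum_i p%:R^-1 * coscol v (c i) B.
have -> : (fun omega => orf_kernel (fun i => col (c i) (O omega)) x y) =
    (fun omega => K (O omega)).
  by apply/funext => w; rewrite orf_kernelE /K mulr_sumr.
have bcos i : bounded_measurable (fun B => p%:R^-1 * coscol v (c i) B).
  apply: bounded_measurableM; first exact: bounded_measurable_cst.
  exact: bounded_measurable_coscol.
have bK : bounded_measurable K by exact: bounded_measurable_sum.
(* An average of [p] cosines; the bound holds for every matrix, as [expectation_haarE] asks. *)
have K1 B : `|K B| <= 1.
  rewrite (le_trans (ler_norm_sum _ _ _))//.
  rewrite [leRHS](_ : _ = \sum_(i < p) p%:R^-1); last first.
    by rewrite sumr_const card_ord -[RHS]mulr_natl mulfV.
  by apply: ler_sum => i _; rewrite normrM ger0_norm// ler_piMr// cos_max.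
have EK : haarE mu K = j z.
  rewrite (haarE_sum hO)// (eq_bigr (fun=> p%:R^-1 * j z)) => [|i _].
    by rewrite sumr_const card_ord -[LHS]mulr_natl mulVKf.
  rewrite haarEZ; last exact: bounded_measurable_coscol.
  by rewrite (haarE_coscol hO).
rewrite /variance unlock (expectation_haarE hO (proj1 bK) K1)/= -/mu EK.
(* The variance unfolds to a covariance, hence a product rather than a square. *)
pose V (B : borel_matrix R d) := (K B - j z) * (K B - j z).
rewrite -[LHS]/('E_P[fun w => V (O w)])%E.
have bV : bounded_measurable V.
  by apply: bounded_measurableM; apply: bounded_measurableD => //;
    exact: bounded_measurable_cst.
have VC B : `|V B| <= (1 + `|j z|) * (1 + `|j z|).
  have KB : `|K B - j z| <= 1 + `|j z| by rewrite (le_trans (ler_normB _ _))// lerD.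
  by rewrite normrM ler_pM.
rewrite (expectation_haarE hO (proj1 bV) VC) -/mu; congr EFin.
have bcc i k : bounded_measurable (fun B => coscol v (c i) B * coscol v (c k) B).
  by apply: bounded_measurableM; exact: bounded_measurable_coscol.
have EKK : haarE mu (fun B => K B * K B) =
    p%:R^-1 * ((1 + j (2 * z)) / 2 + (p%:R - 1) * j (Num.sqrt 2 * z)).
  transitivity (haarE mu (fun B => \sum_i \sum_k
      (p%:R^-1 * p%:R^-1) * (coscol v (c i) B * coscol v (c k) B))).
    apply: eq_haarE => B _; rewrite /K mulr_suml; apply: eq_bigr => i _.
    by rewrite mulr_sumr; apply: eq_bigr => k _; rewrite mulrACA.
  have bccp i k : bounded_measurable
      (fun B => (p%:R^-1 * p%:R^-1) * (coscol v (c i) B * coscol v (c k) B)).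
    by apply: bounded_measurableM => //; exact: bounded_measurable_cst.
  rewrite (haarE_sum hO); last by move=> i; exact: bounded_measurable_sum.
  (* Every row [i] of the double sum has the same value: one diagonal term and p - 1 terms with two
     columns, distinct because [c] is injective. *)
  rewrite (eq_bigr (fun=> (p%:R^-1 * p%:R^-1) *
      ((1 + j (2 * z)) / 2 + (p%:R - 1) * j (Num.sqrt 2 * z)))); last first.
    move=> i _; rewrite (haarE_sum hO)// (bigD1 i)//=.
    rewrite haarEZ// (haarE_coscol_sqr hO)// mulrDr; congr (_ + _).
    rewrite (eq_bigr (fun=> (p%:R^-1 * p%:R^-1) * j (Num.sqrt 2 * z))).
      rewrite sumr_const cardC1 card_ord -[LHS]mulr_natl mulrCA; congr (_ * (_ * _)).
      by rewrite -subn1 natrB// (leq_trans _ hp).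
    move=> k ki; rewrite haarEZ// (haarE_coscolM hO)//.
    by rewrite (inj_eq hc) eq_sym.
  by rewrite sumr_const card_ord -[LHS]mulr_natl; field.
(* As [K] has mean [j z], the expansion leaves E K^2 - (j z)^2; taking 1/p out of the braces
   produces the factor p in front of the last square. *)
transitivity (haarE mu (fun B => K B * K B + (-2 * j z * K B + j z ^+ 2))).
  by apply: eq_haarE => B _; rewrite /V; ring.
rewrite haarED; last 2 first.
- exact: bounded_measurableM.
- apply: bounded_measurableD; last exact: bounded_measurable_cst.
  by apply: bounded_measurableM => //; exact: bounded_measurable_cst.
rewrite haarED; last 2 first.
- by apply: bounded_measurableM => //; exact: bounded_measurable_cst.
- exact: bounded_measurable_cst.
by rewrite haarEZ// EKK EK (haarE_cst hO); field.
Qed.
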